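(* Let $\lambda$ be a nonzero real number and let $r\ge 0$ be an integer. For all integers $n,k\ge 0$ with $n\ge k$, $${n \brace k}_{\lambda}=\sum_{l=k}^{n}\binom{n}{l}{l+r \brace k+r}_{r,\lambda}(-1)^{n-l}r^{n-l}.$$
   Context: For a nonzero real $\lambda$, the generalized falling factorials are $(x)_{0,\lambda}=1$ and $(x)_{n,\lambda}=x(x-\lambda)\cdots(x-(n-1)\lambda)$ for $n\ge 1$. The $\lambda$-analogues of Stirling numbers of the second kind ${n \brace k}_{\lambda}$ and, for an integer $r\ge 0$, the $\lambda$-analogues of $r$-Stirling numbers of the second kind ${n+r \brace k+r}_{r,\lambda}$ ($0\le k\le n$) are the real numbers uniquely determined by the polynomial identities in $x$ $$x^{n}=\sum_{k=0}^{n}{n \brace k}_{\lambda}(x)_{k,\lambda},\qquad (x+r)^{n}=\sum_{k=0}^{n}{n+r \brace k+r}_{r,\lambda}(x)_{k,\lambda},\quad n\ge 0.$$ Convention: $0^0=1$. *)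

(* Defs.v *)
From HB Require Import structures.
From mathcomp Require Import all_boot all_order all_algebra.
From mathcomp Require boolp.
From mathcomp Require Import reals.

Set Implicit Arguments.
Unset Strict Implicit.
Unset Printing Implicit Defensive.

Import Order.TTheory GRing.Theory Num.Theory.
Local Open Scope ring_scope.

(* (x)_{n,lam} = x (x - lam) ... (x - (n-1) lam), over any commutative ring so
   that it can be taken at the indeterminate 'X of {poly R}. *)
Definition gffact (A : comNzRingType) (lam x : A) (n : nat) : A :=
  \prod_(i < n) (x - i%:R * lam).

(* S n k is constrained only for k <= n. *)
Definition is_lam_stirling2 (R : realType) (lam : R) (S : nat -> nat -> R) :
    Prop :=
  forall n : nat,
    'X^n = \sum_(k < n.+1) S n k *: gffact lam%:P 'X k :> {poly R}.

(* As in the bracket notation, both indices are shifted by r: the coefficient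
   of (x)_{k,lam} in (x + r)^n is T (n + r) (k + r). *)
Definition is_lam_r_stirling2 (R : realType) (lam : R) (r : nat)
    (T : nat -> nat -> R) : Prop :=
  forall n : nat,
    ('X + r%:R) ^+ n =
      \sum_(k < n.+1) T (n + r)%N (k + r)%N *: gffact lam%:P 'X k :> {poly R}.

(* The two predicates do determine numbers: such families exist and their
   entries with k <= n are unique. *)
Section WellDefined.
Variables (R : realType) (lam : R).

Let f (k : nat) : {poly R} := gffact lam%:P 'X k.

Lemma gffactX_prod k :
  f k = \prod_(i <- enum 'I_k) ('X - ((i : nat)%:R * lam)%:P).
Proof.
by rewrite big_enum; apply: eq_bigr => i _; rewrite polyCM polyC_natr.
Qed.

Lemma gffactX_monic k : f k \is monic.
Proof. by rewrite gffactX_prod monic_prod_XsubC. Qed.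

Lemma size_gffactX k : size (f k) = k.+1.
Proof. by rewrite gffactX_prod size_prod_XsubC size_enum_ord. Qed.

Lemma gffactX_span n (p : {poly R}) : (size p <= n)%N ->
  exists c : nat -> R, p = \sum_(k < n) c k *: f k.
Proof.
elim: n p => [|n IHn] p szp.
  exists (fun=> 0); rewrite big_ord0; apply/eqP.
  by rewrite -size_poly_leq0.
have [|c Ec] := IHn (p - p`_n *: f n).
  apply/leq_sizeP => j; rewrite leq_eqVlt coefB coefZ => /orP[/eqP<-|ltnj].
    have /monicP := gffactX_monic n.
    by rewrite /lead_coef size_gffactX /= => ->; rewrite mulr1 subrr.
  have [fj pj] : (f n)`_j = 0 /\ p`_j = 0.
    by split; apply: nth_default; [rewrite size_gffactX | apply: leq_trans szp _].
  by rewrite fj pj mulr0 subr0.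
exists (fun k => if k == n then p`_n else c k).
rewrite big_ord_recr /= eqxx -[LHS](subrK (p`_n *: f n)) Ec; congr (_ + _).
by apply: eq_bigr => i _; rewrite ltn_eqF.
Qed.

Lemma gffactX_free n (c d : nat -> R) :
  \sum_(k < n) c k *: f k = \sum_(k < n) d k *: f k ->
  forall k, (k < n)%N -> c k = d k.
Proof.
elim: n => // n IHn; rewrite !big_ord_recr /= => E.
have small (e : nat -> R) : (\sum_(k < n) e k *: f k)`_n = 0.
  rewrite coef_sum big1 // => i _.
  by rewrite coefZ nth_default ?mulr0 // size_gffactX.
have En : c n = d n.
  have /(congr1 (fun p : {poly R} => p`_n)) := E.
  have /monicP := gffactX_monic n; rewrite /lead_coef size_gffactX /= => f1.
  by rewrite !coefD !small !coefZ f1 !mulr1 !add0r.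
move=> k; rewrite ltnS leq_eqVlt => /orP[/eqP-> //|].
by apply: IHn; move: E; rewrite En => /addIr.
Qed.

Lemma lam_r_stirling2_exists (r : nat) :
  exists T : nat -> nat -> R, is_lam_r_stirling2 lam r T.
Proof.
have H n : exists c : nat -> R,
    ('X + r%:R) ^+ n == \sum_(k < n.+1) c k *: f k :> {poly R}.
  have [|c ->] := @gffactX_span n.+1 (('X + r%:R) ^+ n); last by exists c.
  by rewrite -polyC_natr -[_%:P]opprK -polyCN size_exp_XsubC.
have /boolp.choice[c Hc] := H.
exists (fun m j => c (m - r)%N (j - r)%N) => n; rewrite (eqP (Hc n)).
by apply: eq_bigr => i _; rewrite !addnK.
Qed.

Lemma lam_r_stirling2_unique (r : nat) (T T' : nat -> nat -> R) :
  is_lam_r_stirling2 lam r T -> is_lam_r_stirling2 lam r T' ->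
  forall n k, (k <= n)%N -> T (n + r)%N (k + r)%N = T' (n + r)%N (k + r)%N.
Proof.
move=> HT HT' n k lekn.
apply: (@gffactX_free n.+1 (fun k => T (n + r)%N (k + r)%N)
                           (fun k => T' (n + r)%N (k + r)%N)) => //.
by rewrite -HT -HT'.
Qed.

Lemma lam_stirling2_exists :
  exists S : nat -> nat -> R, is_lam_stirling2 lam S.
Proof.
have [T HT] := lam_r_stirling2_exists 0; exists T => n.
rewrite -['X]addr0 HT addn0 addr0.
by apply: eq_bigr => i _; rewrite addn0.
Qed.

Lemma lam_stirling2_unique (S S' : nat -> nat -> R) :
  is_lam_stirling2 lam S -> is_lam_stirling2 lam S' ->
  forall n k, (k <= n)%N -> S n k = S' n k.
Proof.
move=> HS HS' n k lekn; apply: (@gffactX_free n.+1 (S n) (S' n)) => //.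
by rewrite -HS -HS'.
Qed.

End WellDefined.

(* Main.v *)
Require Import Defs.
From HB Require Import structures.
From mathcomp Require Import all_boot all_order all_algebra.
From mathcomp Require Import reals.
From mathcomp Require Import ring.

Set Implicit Arguments.
Unset Strict Implicit.
Unset Printing Implicit Defensive.

Import Order.TTheory GRing.Theory Num.Theory.
Local Open Scope ring_scope.

(* Both sides are the coefficients of 'X^n = (('X + r) - r)^n on the basis of
   generalized falling factorials: expand by the binomial theorem, then expand
   each power of 'X + r in that basis, whose elements are linearly independent. *)

Theorem theorem6 (R : realType) (lam : R) (lam_neq0 : lam != 0) (r : nat)
    (S T : nat -> nat -> R)
    (S_def : is_lam_stirling2 lam S) (T_def : is_lam_r_stirling2 lam r T)
    (n k : nat) (le_kn : (k <= n)%N) :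
  S n k =
    \sum_(k <= l < n.+1)
      'C(n, l)%:R * T (l + r)%N (k + r)%N * (-1) ^+ (n - l) * r%:R ^+ (n - l).
Proof.
pose a l j : R :=
  'C(n, l)%:R * T (l + r)%N (j + r)%N * (-1) ^+ (n - l) * r%:R ^+ (n - l).
apply: (@gffactX_free R lam n.+1 (S n)
          (fun j => \sum_(j <= l < n.+1) a l j)) => //.
(* [addrC] puts [- r%:R] first, so that the index [l] of [exprDn] is the exponent of ['X + r%:R]. *)
rewrite -S_def -['X in LHS](addrK r%:R) addrC exprDn.
(* Triangular sum over [j <= l <= n]: summing over [l] first collects the coefficient of each basis
   element. *)
transitivity (\sum_(l < n.+1) \sum_(j < n.+1 | (j <= l)%N)
                a l j *: gffact lam%:P 'X j); last first.
  rewrite (exchange_big_dep xpredT) //=; apply: eq_bigr => j _.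
  by rewrite big_geq_mkord scaler_suml.
apply: eq_bigr => l _; rewrite T_def.
rewrite (big_ord_widen n.+1
  (fun j => T (l + r)%N (j + r)%N *: gffact lam%:P 'X j)) //.
rewrite mulr_sumr -sumrMnl; apply: eq_bigr => j _.
(* The power of [- r%:R] is a constant polynomial, so it joins the scalar and only an identity in
   [R] remains. *)
rewrite -polyC_natr -polyCN -polyC_exp mul_polyC scalerA scalerMnl /a.
by rewrite (exprNn r%:R) -mulr_natl; congr (_ *: _); ring.
Qed.
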